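(* There exists a constant $C>0$ such that for every level $N$ of the Sierpinski gasket graphs $G_N=(V_N,E_N)$ with unit conductances, every $j\in\{0,1,\dots,N\}$, every $\alpha\in[0,1]$, every $x,y\in V_N$ which are in the same level-$j$ cell, and every $f:\{0,1\}^{V_N}\to\mathbb{R}$, $$\nu_\alpha\big[(\nabla_{xy}f)^2\big]\le C\left(\frac53\right)^{N-j}\mathcal{E}^{\rm EX}_{(G_N,{\bf 1}),\nu_\alpha}(f).$$
   Context: Sierpinski gasket graphs: let $a_0,a_1,a_2$ be the vertices of a nondegenerate triangle in $\mathbb{R}^2$, and let $G_0$ be the complete graph on $V_0=\{a_0,a_1,a_2\}$. For $i\in\{0,1,2\}$ let $\Psi_i:\mathbb{R}^2\to\mathbb{R}^2$, $\Psi_i(x)=\frac12(x-a_i)+a_i$. For $N\ge1$, the level-$N$ graph $G_N=(V_N,E_N)$ is defined inductively by $G_N=\bigcup_{i=0}^2\Psi_i(G_{N-1})$ (i.e. $V_N=\bigcup_i\Psi_i(V_{N-1})$, and $E_N$ is the union over $i$ of the sets of images of edges of $E_{N-1}$ under $\Psi_i$). Every edge of $E_N$ has conductance $1$; the weighted graph is written $(G_N,{\bf 1})$. For a word $w=w_1\cdots w_m\in\{0,1,2\}^m$, $\Psi_w=\Psi_{w_1}\circ\cdots\circ\Psi_{w_m}$ (the identity for the empty word). Two vertices $x,y\in V_N$ are in the same level-$j$ cell, $j\in\{0,\dots,N\}$, if $x,y\in\Psi_w(V_0)$ for some $w\in\{0,1,2\}^j$. For $x,y\in V_N$ and $\zeta\in\{0,1\}^{V_N}$,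 $\zeta^{xy}$ is $\zeta$ with the values at $x$ and $y$ exchanged, and $(\nabla_{xy}f)(\zeta)=f(\zeta^{xy})-f(\zeta)$. The measure $\nu_\alpha$ is the product Bernoulli measure on $\{0,1\}^{V_N}$ with $\nu_\alpha\{\zeta:\zeta(x)=1\}=\alpha$ for all $x\in V_N$, and $\nu_\alpha[h]=\int h\,d\nu_\alpha$. The exclusion process Dirichlet energy is $$\mathcal{E}^{\rm EX}_{(G_N,{\bf 1}),\nu_\alpha}(f)=\frac12\sum_{zw\in E_N}\nu_\alpha\big[(\nabla_{zw}f)^2\big],$$ where the sum counts each undirected edge once. *)

(* Defs.v *)
From mathcomp Require Export all_boot all_order perm all_algebra.
From mathcomp Require Export finmap reals.

Set Implicit Arguments.
Unset Strict Implicit.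
Unset Printing Implicit Defensive.

Import Order.TTheory GRing.Theory Num.Theory.

Local Open Scope ring_scope.
Local Open Scope fset_scope.

Section SierpinskiGasket.
Variables (R : realType) (a : 'I_3 -> 'rV[R]_2).

Definition nondegenerate : bool := free [:: a 1 - a 0; a 2 - a 0].

Definition Psi (i : 'I_3) (p : 'rV[R]_2) : 'rV[R]_2 :=
  2^-1 *: (p - a i) + a i.

(* For w = w_1 ... w_m this is Psi w_1 (... (Psi w_m p)), i.e.
   (Psi w_1 \o ... \o Psi w_m) p. *)
Definition Psi_word (w : seq 'I_3) (p : 'rV[R]_2) : 'rV[R]_2 :=
  foldr Psi p w.

Definition V0 : {fset 'rV[R]_2} := [fset a 0; a 1; a 2].

Fixpoint gasket_V (N : nat) : {fset 'rV[R]_2} :=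
  if N is N'.+1 then \bigcup_(i in 'I_3) Psi i @` gasket_V N' else V0.

(* An undirected edge is the two-element set of its endpoints. *)
Fixpoint gasket_E (N : nat) : {fset {fset 'rV[R]_2}} :=
  if N is N'.+1
  then \bigcup_(i in 'I_3)
         [fset Psi i @` (e : {fset 'rV[R]_2}) | e in gasket_E N']
  else [fset e in fpowerset V0 | #|` e| == 2%N].

Definition gasket_adj (N : nat) : rel (gasket_V N) :=
  fun z w => [fset val z; val w] \in gasket_E N.

Definition same_cell (N j : nat) (x y : gasket_V N) : Prop :=
  exists w : j.-tuple 'I_3,
    (val x \in Psi_word w @` V0) && (val y \in Psi_word w @` V0).

End SierpinskiGasket.

Section Exclusion.
Variables (R : realType) (T : finType).

(* The site x is occupied, zeta(x) = 1, when zeta x = true. *)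
Definition config : predArgType := {ffun T -> bool}.

Definition swap (x y : T) (zeta : config) : config :=
  [ffun z => zeta (tperm x y z)].

Definition nabla (x y : T) (f : config -> R) (zeta : config) : R :=
  f (swap x y zeta) - f zeta.

Definition bernoulli_weight (alpha : R) (zeta : config) : R :=
  \prod_(x : T) (if zeta x then alpha else 1 - alpha).

(* Integral of h against the product Bernoulli(alpha) measure; the
   configuration space is finite, so it is a weighted finite sum. *)
Definition nu (alpha : R) (h : config -> R) : R :=
  \sum_(zeta : config) bernoulli_weight alpha zeta * h zeta.

(* For a symmetric relation adj, the constraint on enum_rank selects exactly
   one orientation of each edge {z, w}, z != w. *)
Definition energy_EX (adj : rel T) (alpha : R) (f : config -> R) : R :=
  2^-1 * \sum_(z : T)
           \sum_(w : T | adj z w && (enum_rank z < enum_rank w)%N)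
             nu alpha (fun zeta => nabla z w f zeta ^+ 2).

End Exclusion.

(* Main.v *)
Require Import Defs.
From mathcomp Require Import ring lra.

(** Write D(x, y) for the exchange energy nu[(nabla_xy f)^2]. For x, y corners
    of a cell of level j, the energy of one exchange between them has to be
    compared with the sum of D over the edges of the cell, which is a copy of
    the graph of level N - j. The proof renormalizes the cell one level at a
    time and shows that

      (sum of D over the sides of a triangle)
        <= 5/3 (sum of D over the sides of its three subtriangles);

    after N - j steps the factor is (5/3)^(N - j), and the sides of the
    smallest triangles are distinct edges of the graph ([darts_uniq]), so their
    sum is bounded by the energy ([darts_sum_renorm], [sum_adj_exch]).

    The step involves six sites only. For a random walk it would be the
    reduction of an electrical network: nine unit conductances are equivalent
    to a triangle with conductances 3/5. Eliminating a vertex o with legs p_i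
    of weights c_i from a network replaces the star by conductances c_i c_j /
    (c_1 + ... + c_k) between the legs. That this does not increase the
    exclusion energy either is the octopus inequality of Caputo, Liggett and
    Richthammer. Stars with three legs suffice here ([level1_network]), and for
    these the inequality has a short direct proof ([octopus_three_legs]): since
    the Bernoulli measure is exchangeable, one may fix the configuration off
    the four sites and the number of particles on them. One particle or one
    hole gives the identity for random walks; two particles live on a hexagon,
    where the inequality comes down to a quadratic form in three variables with
    zero sum ([star_two_particles]). *)

Set Implicit Arguments.
Unset Strict Implicit.
Unset Printing Implicit Defensive.

Import Order.TTheory GRing.Theory Num.Theory.

Local Open Scope ring_scope.

(** * Quadratic forms on the configurations of four sites *)

(** Two of three reals with zero sum have a nonnegative product. If these are
    t2 and t3, then substituting t1 = - (t2 + t3) turns the form into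
      (c1 t1)^2 + (c2 t2 - c3 t3)^2
        + 2 c1 (c2 t2^2 + c3 t3^2 + (c2 + c3) t2 t3).
    The signs of the weights matter: for c1 < 0 the form can be negative. *)
Lemma zero_sum_form_ge0 (R : realFieldType) (c1 c2 c3 t1 t2 t3 : R) :
  0 <= c1 -> 0 <= c2 -> 0 <= c3 -> t1 + t2 + t3 = 0 ->
  0 <= (c1 * t1) ^+ 2 + (c2 * t2) ^+ 2 + (c3 * t3) ^+ 2
       - 2 * (c1 * t1 * (c2 * t2) + c1 * t1 * (c3 * t3) + c2 * t2 * (c3 * t3)).
Proof.
have same_sign (a b c x y z : R) : 0 <= a -> 0 <= b -> 0 <= c ->
    x + y + z = 0 -> 0 <= y * z ->
  0 <= (a * x) ^+ 2 + (b * y) ^+ 2 + (c * z) ^+ 2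
       - 2 * (a * x * (b * y) + a * x * (c * z) + b * y * (c * z)).
  move=> a0 b0 c0 xyz0 yz0.
  have -> : x = - (y + z) by lra.
  have -> : (a * - (y + z)) ^+ 2 + (b * y) ^+ 2 + (c * z) ^+ 2 - 2 *
      (a * - (y + z) * (b * y) + a * - (y + z) * (c * z) + b * y * (c * z))
    = (a * (y + z)) ^+ 2 + (b * y - c * z) ^+ 2
      + 2 * (a * (b * y ^+ 2 + c * z ^+ 2 + (b + c) * (y * z))) by ring.
  by do ?[exact: yz0 | exact: sqr_ge0 | apply: addr_ge0 | apply: mulr_ge0].
move=> c10 c20 c30 t0.
case: (lerP 0 (t2 * t3)) => [t23|t23]; first exact: same_sign.
case: (lerP 0 (t1 * t3)) => [t13|t13].
  have t0' : t2 + t1 + t3 = 0 by lra.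
  by have := @same_sign c2 c1 c3 t2 t1 t3 c20 c10 c30 t0' t13; lra.
have t12 : 0 <= t1 * t2 by nra.
have t0' : t3 + t1 + t2 = 0 by lra.
by have := @same_sign c3 c1 c2 t3 t1 t2 c30 c10 c20 t0' t12; lra.
Qed.

(** The loss is exactly the square of c1 (h1 - g) + c2 (h2 - g) + c3 (h3 - g):
    a single particle is a random walk, and this is the usual elimination of a
    vertex from an electrical network. *)
Lemma star_one_particle (R : realFieldType) (c1 c2 c3 g h1 h2 h3 : R) :
  c1 * c2 * (h1 - h2) ^+ 2 + c1 * c3 * (h1 - h3) ^+ 2 + c2 * c3 * (h2 - h3) ^+ 2
  <= (c1 + c2 + c3) *
     (c1 * (h1 - g) ^+ 2 + c2 * (h2 - g) ^+ 2 + c3 * (h3 - g) ^+ 2).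
Proof.
by have := sqr_ge0 (c1 * (h1 - g) + c2 * (h2 - g) + c3 * (h3 - g)); lra.
Qed.

(** Two particles on a star with three legs: g_i is the value with particles at
    the centre and on leg i, h_ij the value with particles on legs i and j. The
    moves along the legs form the hexagon g1, h12, g2, h23, g3, h13, whose
    opposite sides move a particle along the same leg. Twice the loss is the
    square of the weighted sum of the sums over opposite sides, plus the form
    of [zero_sum_form_ge0] in their differences t1, t2, t3; with the signs
    below these add up to zero because the increments around the hexagon do. *)
Lemma star_two_particles (R : realFieldType)
    (c1 c2 c3 g1 g2 g3 h12 h13 h23 : R) :
  0 <= c1 -> 0 <= c2 -> 0 <= c3 ->
  c1 * c2 * ((h13 - h23) ^+ 2 + (g1 - g2) ^+ 2)
  + c1 * c3 * ((h12 - h23) ^+ 2 + (g1 - g3) ^+ 2)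
  + c2 * c3 * ((h12 - h13) ^+ 2 + (g2 - g3) ^+ 2)
  <= (c1 + c2 + c3) *
     (c1 * ((h12 - g2) ^+ 2 + (h13 - g3) ^+ 2)
      + c2 * ((h12 - g1) ^+ 2 + (h23 - g3) ^+ 2)
      + c3 * ((h13 - g1) ^+ 2 + (h23 - g2) ^+ 2)).
Proof.
move=> c10 c20 c30.
pose t1 := - ((h12 - g2) - (h13 - g3)).
pose t2 := (h12 - g1) - (h23 - g3).
pose t3 := (h23 - g2) - (h13 - g1).
have t0 : t1 + t2 + t3 = 0 by rewrite /t1 /t2 /t3; lra.
have := zero_sum_form_ge0 c10 c20 c30 t0.
have := sqr_ge0 (c1 * (h12 - g2 + (h13 - g3)) + c2 * (h12 - g1 + (h23 - g3))
  + c3 * (h13 - g1 + (h23 - g2))).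
by rewrite /t1 /t2 /t3; lra.
Qed.

(** Here p lists a function of the occupation of a centre and of three legs, in
    this order, so that exchanging two sites permutes two arguments of p. *)
Definition star_defect (R : realFieldType)
    (p : bool -> bool -> bool -> bool -> R) (c1 c2 c3 : R) a b c d : R :=
  (c1 + c2 + c3) * (c1 * (p b a c d - p a b c d) ^+ 2
                    + c2 * (p c b a d - p a b c d) ^+ 2
                    + c3 * (p d b c a - p a b c d) ^+ 2)
  - (c1 * c2 * (p a c b d - p a b c d) ^+ 2
     + c1 * c3 * (p a d c b - p a b c d) ^+ 2
     + c2 * c3 * (p a b d c - p a b c d) ^+ 2).

(** The 24 permutations are enumerated as products of coset representatives of
    the chain of symmetric groups on 2, 3 and 4 letters. *)
Definition sum_S4 (R : realFieldType) (q : bool -> bool -> bool -> bool -> R)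
    a b c d : R :=
  let q1 a b c d := q a b c d + q a b d c in
  let q2 a b c d := q1 a b c d + q1 a c b d + q1 a d c b in
  q2 a b c d + q2 b a c d + q2 c b a d + q2 d b c a.

(** The rearrangements of (a, b, c, d) run evenly over all configurations with
    the same number of particles; with three particles the hole takes the part
    of the particle, and with zero or four nothing can move. *)
Lemma sum_S4_star_defect_ge0 (R : realFieldType)
    (p : bool -> bool -> bool -> bool -> R) (c1 c2 c3 : R) a b c d :
  0 <= c1 -> 0 <= c2 -> 0 <= c3 ->
  0 <= sum_S4 (star_defect p c1 c2 c3) a b c d.
Proof.
move=> c10 c20 c30.
have one_particle := @star_one_particle R c1 c2 c3
  (p true false false false) (p false true false false)
  (p false false true false) (p false false false true).
have one_hole := @star_one_particle R c1 c2 c3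
  (p false true true true) (p true false true true)
  (p true true false true) (p true true true false).
have two_particles := @star_two_particles R c1 c2 c3
  (p true true false false) (p true false true false) (p true false false true)
  (p false true true false) (p false true false true) (p false false true true)
  c10 c20 c30.
rewrite /sum_S4 /star_defect.
by case: a; case: b; case: c; case: d; lra.
Qed.

(** * The three-legged octopus inequality for the exclusion process *)

Section Nu.
Variables (R : realType) (T : finType) (alpha : R).
Implicit Types (f h : config T -> R) (zeta : config T).

Lemma swapK (x y : T) : involutive (@swap T x y).
Proof. by move=> zeta; apply/ffunP=> z; rewrite !ffunE tpermK. Qed.

Lemma bernoulli_weight_swap (x y : T) zeta :
  bernoulli_weight alpha (swap x y zeta) = bernoulli_weight alpha zeta.
Proof.
rewrite /bernoulli_weight [RHS](reindex_inj (@perm_inj _ (tperm x y))) /=.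
by apply: eq_bigr => z _; rewrite ffunE.
Qed.

Lemma nu_swap (x y : T) h : nu alpha (h \o swap x y) = nu alpha h.
Proof.
rewrite /nu [RHS](reindex_inj (inv_inj (swapK x y))) /=.
by apply: eq_bigr => zeta _; rewrite bernoulli_weight_swap.
Qed.

Lemma eq_nu h1 h2 : h1 =1 h2 -> nu alpha h1 = nu alpha h2.
Proof. by move=> eqh; apply: eq_bigr => zeta _; rewrite eqh. Qed.

Lemma nuD h1 h2 : nu alpha (fun z => h1 z + h2 z) = nu alpha h1 + nu alpha h2.
Proof. by rewrite /nu -big_split; apply: eq_bigr => zeta _; rewrite mulrDr. Qed.

Lemma nuZ k h : nu alpha (fun z => k * h z) = k * nu alpha h.
Proof. by rewrite /nu mulr_sumr; apply: eq_bigr => zeta _; rewrite mulrCA. Qed.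

(** Up to the factor [(size s).+1], an average of h over moves that preserve
    the Bernoulli measure. *)
Definition swap_sum (s : seq (T * T)) h zeta : R :=
  h zeta + \sum_(p <- s) h (swap p.1 p.2 zeta).

Lemma nu_swap_sum s h : nu alpha (swap_sum s h) = (size s).+1%:R * nu alpha h.
Proof.
elim: s => [|p s IHs].
  by rewrite mul1r; apply: eq_nu => zeta; rewrite /swap_sum big_nil addr0.
rewrite (eq_nu (h2 := fun z => swap_sum s h z + (h \o swap p.1 p.2) z));
  last first.
  by move=> zeta; rewrite /swap_sum big_cons /= [X in _ + X]addrC addrA.
by rewrite nuD IHs nu_swap -[(size (p :: s)).+1]addn1 natrD mulrDl mul1r.
Qed.

Hypotheses (alpha_ge0 : 0 <= alpha) (alpha_le1 : alpha <= 1).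

Lemma nu_ge0 h : (forall zeta, 0 <= h zeta) -> 0 <= nu alpha h.
Proof.
move=> h_ge0; apply: sumr_ge0 => zeta _; apply: mulr_ge0 => //.
by apply: prodr_ge0 => x _; case: ifP => // _; rewrite subr_ge0.
Qed.

Definition exch f (x y : T) : R := nu alpha (fun zeta => nabla x y f zeta ^+ 2).

Lemma exch_ge0 f x y : 0 <= exch f x y.
Proof. by apply: nu_ge0 => zeta; apply: sqr_ge0. Qed.

Lemma exchC f x y : exch f x y = exch f y x.
Proof. by apply: eq_nu => zeta; rewrite /nabla /swap tpermC. Qed.

Lemma swap_id (x : T) zeta : swap x x zeta = zeta.
Proof. by apply/ffunP=> z; rewrite ffunE tperm1 perm1. Qed.

Lemma exch_id f x : exch f x x = 0.
Proof.
rewrite /exch /nu big1 // => zeta _.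
by rewrite /nabla swap_id subrr expr0n mulr0.
Qed.

Section Patch.
Variables (o x y z : T).
Hypothesis oxyz : uniq [:: o; x; y; z].

(** Writing configurations in this form turns exchanges among o, x, y, z into
    permutations of four booleans, the other sites being mere parameters. *)
Definition patch zeta (a b c d : bool) : config T :=
  [ffun t => if t == o then a else if t == x then b else
             if t == y then c else if t == z then d else zeta t].

Lemma patch_id zeta : patch zeta (zeta o) (zeta x) (zeta y) (zeta z) = zeta.
Proof.
by apply/ffunP=> t; rewrite ffunE; do 4?[case: eqVneq => [->//|_]].
Qed.

Lemma swap_patch zeta :
  ((forall a b c d, swap o x (patch zeta a b c d) = patch zeta b a c d)
 * (forall a b c d, swap o y (patch zeta a b c d) = patch zeta c b a d)
 * (forall a b c d, swap o z (patch zeta a b c d) = patch zeta d b c a)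
 * (forall a b c d, swap x y (patch zeta a b c d) = patch zeta a c b d)
 * (forall a b c d, swap x z (patch zeta a b c d) = patch zeta a d c b)
 * (forall a b c d, swap y z (patch zeta a b c d) = patch zeta a b d c))%type.
Proof.
move: oxyz; rewrite /= !inE !negb_or !andbT.
case/and3P=> /and3P[/negPf ox /negPf oy /negPf oz] /andP[/negPf xy /negPf xz].
move=> /negPf yz.
have sym (u v : T) : (u == v) = false -> (v == u) = false by rewrite eq_sym.
have neqs := (ox, oy, oz, xy, xz, yz, sym _ _ ox, sym _ _ oy, sym _ _ oz,
  sym _ _ xy, sym _ _ xz, sym _ _ yz).
do !split; move=> a b c d; apply/ffunP=> t; rewrite !ffunE;
  case: tpermP => [->|->|/eqP/negPf to /eqP/negPf tx];
  by rewrite ?eqxx ?neqs ?to ?tx.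
Qed.

(** The inequality is false configuration by configuration. Averaging over the
    permutations of o, x, y, z does not change the integral, because the
    Bernoulli measure is exchangeable, and makes the integrand nonnegative
    everywhere. *)
Lemma octopus_three_legs f (c1 c2 c3 : R) : 0 <= c1 -> 0 <= c2 -> 0 <= c3 ->
  c1 * c2 * exch f x y + c1 * c3 * exch f x z + c2 * c3 * exch f y z
  <= (c1 + c2 + c3) * (c1 * exch f o x + c2 * exch f o y + c3 * exch f o z).
Proof.
move=> c10 c20 c30.
pose h (zeta : config T) := (c1 + c2 + c3) * (c1 * nabla o x f zeta ^+ 2
    + c2 * nabla o y f zeta ^+ 2 + c3 * nabla o z f zeta ^+ 2)
  + (-1) * (c1 * c2 * nabla x y f zeta ^+ 2 + c1 * c3 * nabla x z f zeta ^+ 2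
    + c2 * c3 * nabla y z f zeta ^+ 2).
rewrite -subr_ge0 -mulN1r /exch -!nuZ -!nuD -/h -!nuZ -nuD -/h.
pose H := swap_sum [:: (o, x); (o, y); (o, z)]
  (swap_sum [:: (x, y); (x, z)] (swap_sum [:: (y, z)] h)).
suff: 0 <= nu alpha H by rewrite /H !nu_swap_sum !pmulr_rge0 ?ltr0n.
apply: nu_ge0 => zeta; rewrite -(patch_id zeta).
move: (zeta o) (zeta x) (zeta y) (zeta z) => b0 b1 b2 b3.
pose p a b c d := f (patch zeta a b c d).
have hE a b c d : h (patch zeta a b c d) = star_defect p c1 c2 c3 a b c d.
  by rewrite /h /nabla !swap_patch mulN1r.
rewrite /H /swap_sum !big_cons !big_nil /= !swap_patch !hE !addr0 !addrA.
have := sum_S4_star_defect_ge0 p b0 b1 b2 b3 c10 c20 c30.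
by rewrite /sum_S4 !addrA.
Qed.

End Patch.
End Nu.

(** * Renormalization of the level one gasket *)

(** Renormalization uses only this property and the symmetry of the exchange
    energies; both survive composition of D with an injective map such as
    [Psi], which is what makes an induction on the level possible. *)
Definition octopus_on (R : realFieldType) (P : choiceType) (V : {fset P})
    (D : P -> P -> R) : Prop :=
  forall (o p q r : P) (c1 c2 c3 : R),
    uniq [:: o; p; q; r] -> {subset [:: o; p; q; r] <= V} ->
    0 <= c1 -> 0 <= c2 -> 0 <= c3 ->
  c1 * c2 * D p q + c1 * c3 * D p r + c2 * c3 * D q r
  <= (c1 + c2 + c3) * (c1 * D o p + c2 * D o q + c3 * D o r).

(** A, B, C are the corners and x, y, z the midpoints of AB, BC, AC. As an
    electrical network with unit conductances, the nine edges on the right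
    reduce to a triangle ABC with conductances 3/5. The reduction is done with
    stars with three legs only: six stars with weights 3, 2, 5 (scaled by 1/10)
    use up the edges between midpoints; they leave 3/5 on the edges from a
    midpoint to the two adjacent corners, and create 3/10 from it to the
    opposite corner and 3/25 between corners. One star with weights 2, 2, 1 at
    each midpoint then adds 12/25 between corners, and 3/25 + 12/25 = 3/5. *)
Lemma level1_network (R : realFieldType) (P : choiceType) (V : {fset P})
    (D : P -> P -> R) (A B C x y z : P) :
  octopus_on V D -> (forall p q, D p q = D q p) ->
  uniq [:: A; B; C; x; y; z] -> {subset [:: A; B; C; x; y; z] <= V} ->
  D A B + D A C + D B C
  <= 5 / 3 * (D A x + D A z + D x z + D B x + D B y + D x y
              + D C y + D C z + D y z).
Proof.
move=> oct symD uniqP subV.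
pose s := [:: A; B; C; x; y; z]; pose v := nth A s.
have star (o p q r : nat) (c1 c2 c3 : R) :
    uniq [:: o; p; q; r] && all (gtn 6) [:: o; p; q; r] ->
    0 <= c1 -> 0 <= c2 -> 0 <= c3 ->
    c1 * c2 * D (v p) (v q) + c1 * c3 * D (v p) (v r) + c2 * c3 * D (v q) (v r)
    <= (c1 + c2 + c3)
       * (c1 * D (v o) (v p) + c2 * D (v o) (v q) + c3 * D (v o) (v r)).
  case/andP=> u_opqr /allP lt6; apply: oct => //.
    rewrite -[[:: v o; _; _; _]]/(map v [:: o; p; q; r]).
    rewrite map_inj_in_uniq // => k l /lt6 lt_k /lt6 lt_l /eqP.
    by rewrite nth_uniq // => /eqP.
  move=> _ /(mapP (f := v) (s := [:: o; p; q; r]))[k /lt6 lt_k ->].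
  by apply/subV/mem_nth.
(* With the corners held at arbitrary potentials A, B, C the midpoint between A
   and B has potential x = (2 A + 2 B + C) / 5 = (3 A + 2 B + 5 y) / 10; only
   stars whose centre is the weighted mean of its legs lose nothing. *)
have star325 o p q r ok :=
  star o p q r 3 2 5 ok (ler0n _ _) (ler0n _ _) (ler0n _ _).
have star221 o p q r ok :=
  star o p q r 2 2 1 ok (ler0n _ _) (ler0n _ _) (ler0n _ 1).
have := star325 3 0 1 4 isT; have := star325 3 1 0 5 isT.
have := star325 4 1 2 5 isT; have := star325 4 2 1 3 isT.
have := star325 5 0 2 4 isT; have := star325 5 2 0 3 isT.
have := star221 3 0 1 2 isT; have := star221 4 1 2 0 isT.
have := star221 5 0 2 1 isT.
rewrite /v /= (symD y x) (symD z x) (symD z y).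
rewrite !(symD _ A) !(symD _ B) !(symD _ C).
by move=> *; lra.
Qed.

Lemma I3P (i : 'I_3) : [\/ i = 0, i = 1 | i = 2].
Proof.
case: i => [[|[|[|//]]] lt_i]; [apply: Or31 | apply: Or32 | apply: Or33];
  exact: val_inj.
Qed.

Lemma sum_I3 (R : nmodType) (F : 'I_3 -> R) : \sum_i F i = F 0 + F 1 + F 2.
Proof.
rewrite !big_ord_recl big_ord0 addr0 addrA.
by congr (_ + F _ + F _); apply: val_inj.
Qed.

(** * Vertices and edges of the gasket graphs *)

Section Geometry.
Variables (R : realType) (a : 'I_3 -> 'rV[R]_2).
Hypothesis a_nondeg : nondegenerate a.
Local Notation point := 'rV[R]_2.

Lemma Psi_inj i : injective (Psi a i).
Proof.
have two_neq0 : (2^-1 : R) != 0 by rewrite invr_eq0 pnatr_eq0.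
by move=> p q /addIr /(scalerI two_neq0) /addIr.
Qed.

Lemma Psi_word_inj w : injective (Psi_word a w).
Proof. by elim: w => [|i w IHw] p q //= /Psi_inj /IHw. Qed.

Lemma Psi_fix i : Psi a i (a i) = a i.
Proof. by rewrite /Psi subrr scaler0 add0r. Qed.

Lemma Psi_midpoint i p : Psi a i p = 2^-1 *: (p + a i).
Proof.
rewrite /Psi; have {2}-> : a i = 2^-1 *: a i + 2^-1 *: a i.
  by rewrite -scalerDl (_ : 2^-1 + 2^-1 = 1) ?scale1r //; lra.
by rewrite addrA -scalerDr subrK -scalerDr.
Qed.

Lemma Psi_corner i k : Psi a i (a k) = Psi a k (a i).
Proof. by rewrite !Psi_midpoint addrC. Qed.

(** The barycentric coordinates of p with respect to the three corners. *)
Definition bary (i : 'I_3) (p : point) : R :=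
  let c k := coord (in_tuple [:: a 1 - a 0; a 2 - a 0]) k (p - a 0) in
  if i == 0 then 1 - c 0 - c 1 else if i == 1 then c 0 else c 1.

Lemma bary_corner i k : bary i (a k) = (i == k)%:R.
Proof.
have cE m n : coord (in_tuple [:: a 1 - a 0; a 2 - a 0]) m
    [:: a 1 - a 0; a 2 - a 0]`_n = (n == m :> nat)%:R.
  case: (ltnP n 2) => [lt_n2|le2n].
    exact: (@coord_free _ _ _ (in_tuple [:: a 1 - a 0; a 2 - a 0])
      (Ordinal lt_n2) m a_nondeg).
  rewrite nth_default // linear0; case: eqP => // n_m.
  by move: (ltn_ord m); rewrite -n_m ltnNge le2n.
have c0 m := cE m 2; have c1 m := cE m 0; have c2 m := cE m 1.
rewrite /= in c0 c1 c2; rewrite /bary.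
case: (I3P k) => ->; case: (I3P i) => -> /=;
  rewrite ?subrr ?linear0 ?c1 ?c2 /= ?subr0 ?subrr //.
Qed.

Lemma bary_Psi i k p : bary i (Psi a k p) = 2^-1 * (bary i p + (i == k)%:R).
Proof.
rewrite -(bary_corner i k) /bary.
have -> : Psi a k p - a 0 = 2^-1 *: ((p - a 0) + (a k - a 0)).
  rewrite Psi_midpoint addrACA -opprD scalerBr.
  by rewrite -mulr2n -scaler_nat scalerA mulVf ?pnatr_eq0 ?scale1r.
rewrite !linearZ !linearD /=; case: ifP => _; last by case: ifP.
by field.
Qed.

Lemma bary_sum p : \sum_i bary i p = 1.
Proof. by rewrite sum_I3 /bary /=; lra. Qed.

Definition simplex p := forall i, 0 <= bary i p.

Lemma simplex_corner i : simplex (a i).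
Proof. by move=> k; rewrite bary_corner ler0n. Qed.

Lemma simplex_Psi i p : simplex p -> simplex (Psi a i p).
Proof.
move=> p_ge0 k; rewrite bary_Psi mulr_ge0 ?invr_ge0 ?ler0n //.
by rewrite addr_ge0 ?ler0n.
Qed.

Lemma corner_inj : injective a.
Proof.
move=> i k a_ik; have := bary_corner i i; rewrite a_ik bary_corner eqxx.
by case: (i =P k) => // _ /eqP; rewrite eq_sym oner_eq0.
Qed.

Lemma bary_ge1 i p : simplex p -> 1 <= bary i p ->
  forall k, bary k p = (k == i)%:R.
Proof.
move=> p_ge0 p_i k; have := bary_sum p.
rewrite (bigD1 i) //=; case: (eqVneq k i) => [->|k_i].
  have : 0 <= \sum_(l < 3 | l != i) bary l p by apply: sumr_ge0.
  by rewrite /=; lra.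
rewrite (bigD1 k) //=.
have : 0 <= \sum_(l < 3 | (l != i) && (l != k)) bary l p by apply: sumr_ge0.
by have := p_ge0 k; lra.
Qed.

(** The affine function 2 b1 + 6 b2 of the barycentric coordinates takes the
    integer values 0, 2, 6, 1, 4, 3 on the six points. *)
Lemma level1_vertices_uniq :
  uniq [:: a 0; a 1; a 2; Psi a 0 (a 1); Psi a 1 (a 2); Psi a 0 (a 2)].
Proof.
pose g p := 2 * bary 1 p + 6 * bary 2 p.
apply: (@map_uniq _ _ g).
rewrite (_ : map g _ = [seq n%:R : R | n <- [:: 0; 2; 6; 1; 4; 3]%N]).
  by rewrite map_inj_uniq // => m n /eqP; rewrite eqr_nat => /eqP.
rewrite /= /g !bary_Psi !bary_corner /=.
do ![congr cons]; by field.
Qed.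

(** Both orientations of every edge, listed along the recursion that defines
    the gasket, so that a sum over darts splits over the three subcells. *)
Fixpoint darts (n : nat) : seq (point * point) :=
  if n is n'.+1
  then [seq (Psi a i d.1, Psi a i d.2) | i <- enum 'I_3, d <- darts n']
  else [seq (a ik.1, a ik.2)
         | ik <- enum [pred ik : 'I_3 * 'I_3 | ik.1 != ik.2]].

Lemma dartsP n d : d \in darts n.+1 ->
  exists i, exists2 d', d' \in darts n & d = (Psi a i d'.1, Psi a i d'.2).
Proof. by case/allpairsP=> -[i d'] [/= _ d'_n ->]; exists i, d'. Qed.

Lemma darts_simplex n d : d \in darts n ->
  [/\ simplex d.1, simplex d.2 & exists i, bary i d.1 != bary i d.2].
Proof.
elim: n d => [|n IHn] d.
  case/mapP=> -[i k]; rewrite mem_enum inE /= => i_k ->.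
  split; [exact: simplex_corner | exact: simplex_corner | exists i].
  by rewrite !bary_corner eqxx (negPf i_k) oner_eq0.
case/dartsP=> i [d' /IHn[s1 s2 [k d'k]] ->]; split; try exact: simplex_Psi.
exists k; rewrite !bary_Psi; apply: contraNneq d'k => /mulfI.
by rewrite invr_eq0 pnatr_eq0 => /(_ isT) /addIr ->.
Qed.

(** Different cells of the same level share no edge: a point in the images
    of the triangle under both [Psi i] and [Psi k] has barycentric coordinate
    1/2 at i and at k, so it is the common vertex of the two cells, whereas a
    dart has two distinct ends. *)
Lemma darts_uniq n : uniq (darts n).
Proof.
elim: n => [|n IHn].
  rewrite map_inj_in_uniq ?enum_uniq // => -[i k] [i' k'] _ _ /=.
  by case=> /corner_inj -> /corner_inj ->.
apply: allpairs_uniq (enum_uniq _) IHn _.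
move=> _ _ /allpairsP[[i d] [/= _ dn ->]] /allpairsP[[k d'] [/= _ d'n ->]] /=.
case=> e1 e2; have i_k : i = k.
  apply/eqP; apply: contraT => i_k.
  have [s1 s2 _] := darts_simplex dn.
  have [s1' s2' [l /negP[]]] := darts_simplex d'n.
  have corner p p' : simplex p -> simplex p' -> Psi a i p = Psi a k p' ->
      bary l p' = (l == i)%:R.
    move=> sp sp' e; apply: bary_ge1 => //.
    have := congr1 (bary i) e; rewrite !bary_Psi eqxx (negPf i_k) /=.
    by have := sp i; lra.
  by rewrite (corner _ _ s1 s1' e1) (corner _ _ s2 s2' e2).
rewrite i_k in e1 e2 *; congr (_, _).
by rewrite (surjective_pairing d) (Psi_inj e1) (Psi_inj e2) -surjective_pairing.
Qed.

Lemma Psi_gasket_V n i p : p \in gasket_V a n -> Psi a i p \in gasket_V a n.+1.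
Proof.
by move=> pn; apply/bigfcupP; exists i; rewrite ?mem_index_enum ?in_imfset.
Qed.

Lemma Psi_gasket_E n i p q : [fset p; q]%fset \in gasket_E a n ->
  [fset Psi a i p; Psi a i q]%fset \in gasket_E a n.+1.
Proof.
move=> e; apply/bigfcupP; exists i; rewrite ?mem_index_enum //.
by rewrite -imfset_fset2; apply/imfsetP; exists [fset p; q]%fset.
Qed.

Lemma corner_V0 i : a i \in V0 a.
Proof. by rewrite !inE; case: (I3P i) => ->; rewrite eqxx ?orbT. Qed.

Lemma V0P p : reflect (exists i, p = a i) (p \in V0 a).
Proof.
apply: (iffP idP) => [|[i ->]]; last exact: corner_V0.
by rewrite !inE => /orP[/orP[]|] /eqP ->; eexists.
Qed.

Lemma corner_gasket_V n i : a i \in gasket_V a n.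
Proof.
elim: n => [|n IHn]; first exact: corner_V0.
by rewrite -(Psi_fix i) Psi_gasket_V.
Qed.

Lemma darts_gasket n d : d \in darts n ->
  [/\ d.1 \in gasket_V a n, d.2 \in gasket_V a n
    & [fset d.1; d.2]%fset \in gasket_E a n].
Proof.
elim: n d => [|n IHn] d.
  case/mapP=> -[i k]; rewrite mem_enum inE /= => i_k ->; rewrite !corner_V0.
  split=> //; apply/imfsetP; exists [fset a i; a k]%fset => //=.
  rewrite inE /= fpowersetE fsubUset !fsub1set !corner_V0 cardfs2.
  by rewrite (inj_eq corner_inj) i_k.
case/dartsP=> i [d' /IHn[V1 V2 E12] ->].
by split; [apply: Psi_gasket_V | apply: Psi_gasket_V | apply: Psi_gasket_E].
Qed.

Lemma Psi_word_gasket_V w n p : p \in gasket_V a n ->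
  Psi_word a w p \in gasket_V a (size w + n).
Proof. by elim: w => //= i w IHw /IHw; apply: Psi_gasket_V. Qed.

Lemma Psi_word_gasket_E w n p q : [fset p; q]%fset \in gasket_E a n ->
  [fset Psi_word a w p; Psi_word a w q]%fset \in gasket_E a (size w + n).
Proof. by elim: w => //= i w IHw /IHw; apply: Psi_gasket_E. Qed.

Lemma sum_corner_darts (D : point -> point -> R) :
  (forall p q, D p q = D q p) ->
  \sum_(d <- darts 0) D d.1 d.2
  = 2 * (D (a 0) (a 1) + D (a 0) (a 2) + D (a 1) (a 2)).
Proof.
move=> symD; rewrite /darts big_map big_enum /=.
rewrite (eq_bigl (fun ik => true && (ik.1 != ik.2))); last first.
  by move=> ik; rewrite inE.
rewrite -(pair_big_dep xpredT (fun i k => i != k)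
                       (fun i k => D (a i) (a k))) /=.
under eq_bigr do rewrite big_mkcond.
rewrite !sum_I3 /=.
rewrite (symD (a 1) (a 0)) (symD (a 2) (a 0)) (symD (a 2) (a 1)).
by ring.
Qed.

(** Each of the n steps replaces a triangle by its three subtriangles at the
    cost of the factor 5/3; the induction hypothesis is applied to D
    transported to each subcell. *)
Lemma darts_sum_renorm n (D : point -> point -> R) :
  octopus_on (gasket_V a n) D -> (forall p q, D p q = D q p) ->
  \sum_(d <- darts 0) D d.1 d.2
  <= (5 / 3) ^+ n * \sum_(d <- darts n) D d.1 d.2.
Proof.
elim: n D => [|n IHn] D octD symD; first by rewrite expr0 mul1r.
pose Di i p q := D (Psi a i p) (Psi a i q).
have symDi i p q : Di i p q = Di i q p by apply: symD.
have octDi i : octopus_on (gasket_V a n) (Di i).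
  move=> o p q r c1 c2 c3 u_opqr sub_opqr; apply: octD.
    rewrite -[[:: _; _; _; _]]/(map (Psi a i) [:: o; p; q; r]).
    by rewrite map_inj_uniq //; apply: Psi_inj.
  move=> _ /(mapP (f := Psi a i) (s := [:: o; p; q; r]))[v /sub_opqr v_n ->].
  exact: Psi_gasket_V.
have step : \sum_(d <- darts 0) D d.1 d.2
    <= 5 / 3 * \sum_(i < 3) \sum_(d <- darts 0) Di i d.1 d.2.
  have sub6 : {subset [:: a 0; a 1; a 2;
      Psi a 0 (a 1); Psi a 1 (a 2); Psi a 0 (a 2)] <= gasket_V a n.+1}.
    have cV := corner_gasket_V n.+1.
    have mV i k := Psi_gasket_V i (corner_gasket_V n k).
    by apply/allP; do !(apply/andP; split; first by [exact: cV | exact: mV]).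
  have := level1_network octD symD level1_vertices_uniq sub6.
  rewrite sum_I3 !sum_corner_darts // /Di !Psi_fix.
  rewrite (Psi_corner 1 0) (Psi_corner 2 0) (Psi_corner 2 1).
  rewrite (symD (Psi a 0 (a 1)) (a 1)) (symD (Psi a 0 (a 2)) (a 2)).
  rewrite (symD (Psi a 1 (a 2)) (a 2)).
  rewrite (symD (Psi a 0 (a 2)) (Psi a 1 (a 2))).
  by move=> *; lra.
apply: le_trans step _; rewrite exprS -[leRHS]mulrA.
rewrite ler_wpM2l ?divr_ge0 ?ler0n //=.
rewrite big_allpairs_dep big_enum mulr_sumr ler_sum // => i _.
exact: IHn.
Qed.
End Geometry.

(** * The moving particle estimate *)

(** The factor 4 undoes the 1/2 in the energy and the choice of one orientation
    per edge. *)
Lemma sum_adj_exch (R : realType) (T : finType) (alpha : R) (adj : rel T)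
    (f : config T -> R) : symmetric adj ->
  \sum_z \sum_(w | adj z w) exch alpha f z w = 4 * energy_EX adj alpha f.
Proof.
move=> symadj; pose lt (z w : T) := (enum_rank z < enum_rank w)%N.
pose S := \sum_z \sum_(w | adj z w && lt z w) exch alpha f z w.
suff -> : \sum_z \sum_(w | adj z w) exch alpha f z w = S + S.
  by rewrite /energy_EX -/S; lra.
have {2}-> : S = \sum_z \sum_(w | adj z w && lt w z) exch alpha f z w.
  rewrite /S (exchange_big_dep xpredT) //=; apply: eq_bigr => z _.
  by apply: eq_big => w; [rewrite symadj | rewrite exchC].
rewrite /S -big_split; apply: eq_bigr => z _ /=.
rewrite (bigID (lt z)) /=; congr (_ + _).
rewrite [LHS]big_mkcond [RHS]big_mkcond; apply: eq_bigr => w _.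
rewrite /lt -leqNgt leq_eqVlt; case: eqP => //= /ord_inj/enum_rank_inj ->.
by rewrite ltnn andbF exch_id if_same.
Qed.

Theorem proposition3 (R : realType) (a : 'I_3 -> 'rV[R]_2)
    (a_nondeg : nondegenerate a) :
  exists C : R, 0 < C /\
    forall (N j : nat) (le_jN : (j <= N)%N)
           (alpha : R) (alpha_ge0 : 0 <= alpha) (alpha_le1 : alpha <= 1)
           (x y : gasket_V a N) (xy_cell : same_cell j x y)
           (f : config (gasket_V a N) -> R),
      nu alpha (fun zeta => nabla x y f zeta ^+ 2)
        <= C * (5 / 3) ^+ (N - j) * energy_EX (@gasket_adj R a N) alpha f.
Proof.
exists 4; split; first by rewrite ltr0n.
move=> N j le_jN alpha alpha_ge0 alpha_le1 x y [w /andP[x_w y_w]] f.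
have size_wN : (size w + (N - j))%N = N by rewrite size_tuple subnKC.
have posV p : p \in gasket_V a (N - j) -> Psi_word a w p \in gasket_V a N.
  by move=> /(Psi_word_gasket_V w); rewrite size_wN.
(* [x] is a default value: [pos] matters only at points of level [N - j]. *)
pose pos p := insubd x (Psi_word a w p).
have val_pos p : p \in gasket_V a (N - j) -> val (pos p) = Psi_word a w p.
  by move=> /posV; apply: insubdK.
have pos_inj : {in gasket_V a (N - j) &, injective pos}.
  by move=> p q pV qV /(congr1 val); rewrite !val_pos // => /Psi_word_inj.
pose D p q := exch alpha f (pos p) (pos q).
have octD : octopus_on (gasket_V a (N - j)) D.
  move=> o p q r c1 c2 c3 u_opqr sub_opqr; apply: octopus_three_legs => //.
  rewrite -[[:: _; _; _; _]]/(map pos [:: o; p; q; r]) map_inj_in_uniq //.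
  by move=> p1 p2 /sub_opqr p1V /sub_opqr p2V; apply: pos_inj.
have symD p q : D p q = D q p by apply: exchC.
have corner_pos (z : gasket_V a N) :
    val z \in [fset Psi_word a w v | v in V0 a]%fset -> exists i, z = pos (a i).
  case/imfsetP=> _ /V0P[i ->] z_i; exists i; apply: val_inj.
  by rewrite val_pos ?corner_gasket_V.
case: (corner_pos _ x_w) => i ->; case: (corner_pos _ y_w) => k ->.
have energy_ge0 : 0 <= energy_EX (@gasket_adj R a N) alpha f.
  rewrite mulr_ge0 ?invr_ge0 ?ler0n // sumr_ge0 // => z _.
  by rewrite sumr_ge0 // => z' _; apply: exch_ge0.
have rho_ge0 : 0 <= (5 / 3) ^+ (N - j) :> R.
  by rewrite exprn_ge0 ?divr_ge0 ?ler0n.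
rewrite -/(exch alpha f (pos (a i)) (pos (a k))).
have [->|i_k] := eqVneq i k.
  by rewrite exch_id mulr_ge0 // mulr_ge0 ?ler0n.
(* The pair x, y is itself one of the six darts of its cell. *)
apply: (@le_trans _ _ (\sum_(d <- darts a 0) D d.1 d.2)).
  have ik0 : (a i, a k) \in darts a 0.
    by apply/mapP; exists (i, k); rewrite // mem_enum inE.
  rewrite (big_rem _ ik0) /= lerDl sumr_ge0 // => d _; exact: exch_ge0.
apply: le_trans (darts_sum_renorm a_nondeg octD symD) _.
rewrite [4 * _]mulrC -[leRHS]mulrA ler_wpM2l //.
rewrite -sum_adj_exch; last by move=> z z'; rewrite /gasket_adj fsetUC.
rewrite pair_big_dep /=.
rewrite -(big_map (fun d => (pos d.1, pos d.2)) xpredT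
                  (fun zz => exch alpha f zz.1 zz.2)).
rewrite big_uniq /=; last first.
  rewrite map_inj_in_uniq ?darts_uniq // => -[p q] [p' q'].
  move=> /(darts_gasket a_nondeg)[/= pV qV _].
  move=> /(darts_gasket a_nondeg)[/= p'V q'V _].
  by case=> /pos_inj -> // /pos_inj ->.
(* The darts of the cell are distinct and adjacent in the whole graph. *)
rewrite big_mkcond [leRHS]big_mkcond; apply: ler_sum => -[z z'] _ /=.
case: ifP => [/mapP[d d_n [-> ->]]|_]; last first.
  by case: ifP => // _; apply: exch_ge0.
have [d1V d2V E12] := darts_gasket a_nondeg d_n.
rewrite ifT // /gasket_adj !val_pos //.
by have := Psi_word_gasket_E w E12; rewrite size_wN.
Qed.
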